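(* Let $Q\in\mathbb{R}^{n\times n}$ be symmetric positive definite and let $A\in\mathbb{R}^{m\times n}$ be of full rank. Let $R_qR_q^\top=Q^{-1}$ be the Choleski factorization of $Q^{-1}$, let $s$ be the dimension of the null-space of $A$, and let $P\in\mathbb{R}^{n\times(n-s)}$ be a matrix whose columns are orthonormal vectors spanning the range of $R_q^\top A^\top$. For a diagonal positive definite matrix $L\in\mathbb{R}^{m\times m}$, let $\lambda_{\max}(LAQ^{-1}A^\top L)$ and $\lambda_{1}(LAQ^{-1}A^\top L)$ be the largest and the smallest nonzero eigenvalues of $LAQ^{-1}A^\top L$. The diagonal scaling matrix $L^\star$ (diagonal, positive definite) that minimizes the eigenvalue ratio $\lambda_{\max}(LAQ^{-1}A^\top L)/\lambda_1(LAQ^{-1}A^\top L)$ can be obtained by solving the convex problem $$\begin{array}{ll}\underset{t\in\mathbb{R},\,w\in\mathbb{R}^m}{\text{minimize}} & t\\ \text{subject to} & W=\mathrm{diag}(w),\; w>0,\\ & tI-R_q^\top A^\top WAR_q\succeq0,\\ & P^\top(R_q^\top A^\top WAR_q-I)P\succeq0,\end{array}$$ and setting $L^\star=(W^\star)^{1/2}$, where $W^\star=\mathrm{diag}(w^\star)$ for an optimal solution $(t^\star,w^\star)$.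
   Context: $w>0$ is componentwise; $X\succeq0$ means $X$ is symmetric positive semidefinite; $\mathrm{diag}(w)$ is the diagonal matrix with diagonal $w$. *)

(* Defs.v *)
From HB Require Import structures.
From mathcomp Require Import all_boot all_order all_algebra.
From mathcomp Require Import all_classical all_reals all_analysis.

Set Implicit Arguments.
Unset Strict Implicit.
Unset Printing Implicit Defensive.

Import Order.TTheory GRing.Theory Num.Theory.

Local Open Scope classical_set_scope.
Local Open Scope ring_scope.

Definition psdmx (R : realType) (k : nat) (X : 'M[R]_k) : Prop :=
  X^T = X /\ forall x : 'cV[R]_k, 0 <= (x^T *m X *m x) 0 0.

Definition pdmx (R : realType) (k : nat) (X : 'M[R]_k) : Prop :=
  X^T = X /\ forall x : 'cV[R]_k, x != 0 -> 0 < (x^T *m X *m x) 0 0.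

(* [is_trig_mx] means lower triangular. *)
Definition cholesky_factor (R : realType) (k : nat) (M F : 'M[R]_k) : Prop :=
  [/\ is_trig_mx F, forall i, 0 < F i i & F *m F^T = M].

(* Both values default to 0 when no such eigenvalue exists. *)
Definition lambda_max (R : realType) (k : nat) (M : 'M[R]_k) : R :=
  xget 0 [set a | eigenvalue M a /\ forall b, eigenvalue M b -> b <= a].

Definition lambda_1 (R : realType) (k : nat) (M : 'M[R]_k) : R :=
  xget 0 [set a | [/\ eigenvalue M a, a != 0 &
                      forall b, eigenvalue M b -> b != 0 -> a <= b]].

Definition eigenvalue_ratio (R : realType) (m n : nat)
    (Q : 'M[R]_n) (A : 'M[R]_(m, n)) (L : 'M[R]_m) : R :=
  let M := L *m A *m invmx Q *m A^T *m L in lambda_max M / lambda_1 M.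

Definition diag_pd (R : realType) (m : nat) : set 'M[R]_m :=
  [set L | is_diag_mx L /\ pdmx L].

Definition minimizes (T : Type) (R : realType) (f : T -> R) (D : set T)
    (x : T) : Prop :=
  D x /\ forall y, D y -> f x <= f y.

(* The decision variable is the pair (t, w); w is stored as a row vector
   because [diag_mx] takes one. *)
Definition decision (R : realType) (m : nat) := (R^o * 'rV[R]_m)%type.

Definition objective (R : realType) (m : nat) (z : decision R m) : R^o := z.1.

Definition feasible (R : realType) (m n r : nat) (A : 'M[R]_(m, n))
    (Rq : 'M[R]_n) (P : 'M[R]_(n, r)) : set (decision R m) :=
  [set z | let W := diag_mx z.2 in
    [/\ forall i, 0 < z.2 0 i,
        psdmx (z.1%:M - Rq^T *m A^T *m W *m A *m Rq) &
        psdmx (P^T *m (Rq^T *m A^T *m W *m A *m Rq - 1%:M) *m P)]].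

Definition convex_problem (R : realType) (E : lmodType R)
    (f : E -> R^o) (D : set E) : Prop :=
  @convex_set R E D /\ @convex_function R E D f.

(* For positive w this is the positive definite square root of diag(w). *)
Definition sqrt_diag_mx (R : realType) (m : nat) (w : 'rV[R]_m) : 'M[R]_m :=
  diag_mx (map_mx Num.sqrt w).

(* Main.v *)
(* Let [C = A Rq] and [K = C P], so that [C = K P^T] and [K] is injective. For
   [L = diag(w)^(1/2)] the matrix [L A Q^-1 A^T L] is [B B^T] with [B = L K],
   whose nonzero eigenvalues are all the eigenvalues of the positive definite
   matrix [B^T B = K^T diag(w) K]. The two matrix inequalities hence say
   [lambda_max <= t] and [1 <= lambda_1]: a feasible [(t, w)] has eigenvalue
   ratio at most [t], and conversely every positive [w] becomes feasible, with
   [t] equal to its ratio, after division by [lambda_1]. *)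
Require Import Defs.
From HB Require Import structures.
From mathcomp Require Import all_boot all_order all_algebra.
From mathcomp Require Import all_classical all_reals all_analysis.
From mathcomp Require Import ring lra.

Set Implicit Arguments.
Unset Strict Implicit.
Unset Printing Implicit Defensive.

Import Order.TTheory GRing.Theory Num.Theory.

Local Open Scope classical_set_scope.
Local Open Scope ring_scope.

(** * Quadratic forms and positive semidefinite matrices *)

Definition qf (R : realType) (k : nat) (X : 'M[R]_k) (x : 'cV[R]_k) : R :=
  (x^T *m X *m x) 0 0.

Section QuadraticForms.
Context (R : realType).
Implicit Types (k l : nat) (a b c e : R).

Lemma qfD k (X Y : 'M[R]_k) x : qf (X + Y) x = qf X x + qf Y x.
Proof. by rewrite /qf mulmxDr mulmxDl mxE. Qed.

Lemma qfZ k c (X : 'M[R]_k) x : qf (c *: X) x = c * qf X x.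
Proof. by rewrite /qf -scalemxAr -scalemxAl mxE. Qed.

Lemma qfB k (X Y : 'M[R]_k) x : qf (X - Y) x = qf X x - qf Y x.
Proof. by rewrite -scaleN1r qfD qfZ mulN1r. Qed.

Lemma qf_scalar k c (x : 'cV[R]_k) : qf c%:M x = c * qf 1%:M x.
Proof. by rewrite -[in LHS]scalemx1 qfZ. Qed.

Lemma qf_congr k l (B : 'M[R]_(l, k)) (X : 'M[R]_l) x :
  qf (B^T *m X *m B) x = qf X (B *m x).
Proof. by rewrite /qf trmx_mul !mulmxA. Qed.

Lemma qf1E k (x : 'cV[R]_k) : qf 1%:M x = \sum_i x i 0 ^+ 2.
Proof.
by rewrite /qf mulmx1 mxE; apply: eq_bigr => i _; rewrite mxE expr2.
Qed.

Lemma qf1_ge0 k (x : 'cV[R]_k) : 0 <= qf 1%:M x.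
Proof. by rewrite qf1E sumr_ge0 // => i _; rewrite sqr_ge0. Qed.

Lemma qf1_eq0 k (x : 'cV[R]_k) : (qf 1%:M x == 0) = (x == 0).
Proof.
apply/idP/eqP => [|->]; last by rewrite /qf mulmx0 mxE.
rewrite qf1E psumr_eq0 => [/allP h|i _]; last exact: sqr_ge0.
apply/matrixP => i j; rewrite ord1 mxE.
by have /= := h i (mem_index_enum _); rewrite sqrf_eq0 => /eqP.
Qed.

Lemma qf1_gt0 k (x : 'cV[R]_k) : x != 0 -> 0 < qf 1%:M x.
Proof. by move=> x0; rewrite lt_def qf1_eq0 x0 qf1_ge0. Qed.

(** Every product of two coordinates is at most the squared norm in absolute value, so the sum of
    the absolute entries is a bound; the added 1 makes it invertible. *)
Lemma qf_bounded k (Y : 'M[R]_k) :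
  exists2 c, 0 < c & forall x, qf Y x <= c * qf 1%:M x.
Proof.
exists (1 + \sum_j \sum_i `|Y i j|) => [|x].
  by rewrite ltr_wpDr // sumr_ge0 // => j _; rewrite sumr_ge0.
rewrite mulrDl mul1r ler_wpDl ?qf1_ge0 //.
rewrite /qf mxE mulr_suml ler_sum // => j _.
rewrite mxE !mulr_suml ler_sum // => i _; rewrite mxE.
have leq1 (h : 'I_k) : x h 0 ^+ 2 <= qf 1%:M x.
  rewrite qf1E (bigD1 h) //= lerDl sumr_ge0 // => ? _; exact: sqr_ge0.
have hij : `|x i 0 * x j 0| <= qf 1%:M x.
  rewrite ler_norml; have := leq1 i; have := leq1 j.
  have := sqr_ge0 (x i 0 - x j 0); have := sqr_ge0 (x i 0 + x j 0).
  by move=> *; apply/andP; split; nra.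
apply: le_trans (ler_norm _) _.
by rewrite mulrAC normrM mulrC ler_wpM2l.
Qed.

Lemma psdmxZ k c (X : 'M[R]_k) : 0 <= c -> psdmx X -> psdmx (c *: X).
Proof.
move=> c0 [sX pX]; split; first by rewrite linearZ /= sX.
by move=> x; rewrite -/(qf _ _) qfZ mulr_ge0 //; exact: pX.
Qed.

Lemma psdmxD k (X Y : 'M[R]_k) : psdmx X -> psdmx Y -> psdmx (X + Y).
Proof.
move=> [sX pX] [sY pY]; split; first by rewrite linearD /= sX sY.
by move=> x; rewrite -/(qf _ _) qfD addr_ge0 //; [exact: pX|exact: pY].
Qed.

Lemma psdmx_congr k l (B : 'M[R]_(l, k)) (X : 'M[R]_l) :
  psdmx X -> psdmx (B^T *m X *m B).
Proof.
move=> [sX pX]; split; first by rewrite !trmx_mul trmxK sX mulmxA.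
by move=> x; rewrite -/(qf _ _) qf_congr; exact: pX.
Qed.

Lemma psdmx_scalar k c : 0 <= c -> psdmx (c%:M : 'M[R]_k).
Proof.
move=> c0; split; first by rewrite tr_scalar_mx.
by move=> x; rewrite -/(qf _ _) qf_scalar mulr_ge0 // qf1_ge0.
Qed.

Lemma psdmx_scalar_ge0 k c : (0 < k)%N -> psdmx (c%:M : 'M[R]_k) -> 0 <= c.
Proof.
move=> k0 [_ /(_ (delta_mx (Ordinal k0) 0))].
by rewrite trmx_delta -rowE -colE !mxE eqxx mulr1n.
Qed.

(** Stands in for diagonalization: an upper bound [c] on the form of [invmx X] yields the lower
    bound [c^-1] on that of [X]. *)
Lemma psdmx_unit_coercive k (X : 'M[R]_k) : psdmx X -> X \in unitmx ->
  exists2 e, 0 < e & psdmx (X - e%:M).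
Proof.
move=> [sX pX] uX; have [c c0 hc] := qf_bounded (invmx X).
exists c^-1; first by rewrite invr_gt0.
split; first by rewrite linearB /= sX tr_scalar_mx.
move=> x; rewrite -/(qf _ _) qfB qf_scalar subr_ge0.
have sY : (invmx X)^T = invmx X by rewrite trmx_inv sX.
(* Nonnegativity of [qf X (B *m x)] for this [B] is the required bound. *)
pose B := 1%:M - c^-1 *: invmx X.
have BXB : B^T *m X *m B = X - (2 / c)%:M + c^-1 ^+ 2 *: invmx X.
  have sB : B^T = B by rewrite /B linearB /= tr_scalar_mx linearZ /= sY.
  rewrite sB /B mulmxBl mul1mx -scalemxAl mulVmx // mulmxBr mulmx1.
  rewrite -scalemxAr mulmxBl mulmxV // -scalemxAl mul1mx scalemx1.
  by apply/matrixP => i j; rewrite !mxE; ring.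
have := pX (B *m x).
rewrite -/(qf _ _) -qf_congr BXB qfD qfB qf_scalar qfZ.
have := hc x; set q := qf _ x; set p := qf _ x; set y := qf _ x => qc.
(* The inverse term absorbs one of the two copies of [c^-1 * p]; the other one remains as the
   bound. *)
have : c^-1 ^+ 2 * q <= c^-1 * p.
  by rewrite expr2 -mulrA ler_pM2l ?invr_gt0 // ler_pdivrMl.
lra.
Qed.

(** * Extreme eigenvalues of symmetric matrices *)

Lemma eigenvalue_colP k (X : 'M[R]_k) a : X^T = X ->
  reflect (exists2 x : 'cV_k, X *m x = a *: x & x != 0) (eigenvalue X a).
Proof.
move=> sX; apply: (iffP eigenvalueP) => -[x hx x0].
  exists x^T; last by rewrite trmx_eq0.
  by rewrite -{1}sX -trmx_mul hx linearZ.
exists x^T; last by rewrite trmx_eq0.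
by rewrite -{1}sX -trmx_mul hx linearZ.
Qed.

Lemma qf_eigen k (X : 'M[R]_k) a x : X *m x = a *: x ->
  qf X x = a * qf 1%:M x.
Proof. by move=> hx; rewrite /qf -mulmxA hx -scalemxAr mulmx1 mxE. Qed.

Lemma psdmx_le_eigenvalue k (X : 'M[R]_k) a b : X^T = X ->
  psdmx (X - a%:M) -> eigenvalue X b -> a <= b.
Proof.
move=> sX [_ pX] /(eigenvalue_colP _ sX)[x hx x0]; have := pX x.
rewrite -/(qf _ _) qfB qf_scalar (qf_eigen hx).
by rewrite -mulrBl pmulr_lge0 ?qf1_gt0 // subr_ge0.
Qed.

Lemma psdmx_ge_eigenvalue k (X : 'M[R]_k) a b : X^T = X ->
  psdmx (b%:M - X) -> eigenvalue X a -> a <= b.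
Proof.
move=> sX [_ pX] /(eigenvalue_colP _ sX)[x hx x0]; have := pX x.
rewrite -/(qf _ _) qfB qf_scalar (qf_eigen hx).
by rewrite -mulrBl pmulr_lge0 ?qf1_gt0 // subr_ge0.
Qed.

(* The least eigenvalue is the supremum of the [a] with [X - a] positive
   semidefinite: were [X - sup] invertible, it would be coercive and the
   supremum could be increased. *)
Lemma min_eigenvalue k (X : 'M[R]_k) : (0 < k)%N -> X^T = X ->
  exists2 a, eigenvalue X a & psdmx (X - a%:M).
Proof.
move=> k0 sX; pose E := [set a | psdmx (X - a%:M)].
have sXa a : (X - a%:M)^T = X - a%:M by rewrite linearB /= sX tr_scalar_mx.
have E0 : E !=set0.
  have [c c0 hc] := qf_bounded (-1 *: X).
  exists (- c); split=> // x; rewrite -/(qf _ _) qfB qf_scalar.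
  by have := hc x; rewrite qfZ; lra.
(* Rayleigh quotients bound [E] from above, and their being upper bounds later puts [sup E] itself
   in [E]. *)
have ubE (x : 'cV_k) : x != 0 -> ubound E (qf X x / qf 1%:M x).
  move=> x0 a [_ /(_ x)]; rewrite -/(qf _ _) qfB qf_scalar subr_ge0.
  by rewrite ler_pdivlMr ?qf1_gt0.
have x1 : (const_mx 1 : 'cV[R]_k) != 0.
  apply/eqP => /matrixP /(_ (Ordinal k0) 0); rewrite !mxE => /eqP.
  by rewrite oner_eq0.
have supE : psdmx (X - (sup E)%:M).
  split=> // x; rewrite -/(qf _ _) qfB qf_scalar subr_ge0.
  have [->|x0] := eqVneq x 0; first by rewrite /qf !mulmx0 !mxE mulr0.
  by rewrite -ler_pdivlMr ?qf1_gt0 //; apply: ge_sup => //; exact: ubE.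
(* Not being an eigenvalue means that [X - (sup E)%:M] is invertible. *)
exists (sup E) => //; rewrite /eigenvalue /eigenspace kermx_eq0.
rewrite row_free_unit; apply/negP => /(psdmx_unit_coercive supE)[e e0 he].
have : sup E + e <= sup E.
  apply: ub_le_sup; first by eexists; exact: ubE x1.
  by rewrite /E /= raddfD /= opprD addrA.
by rewrite gerDl leNgt e0.
Qed.

Lemma max_eigenvalue k (X : 'M[R]_k) : (0 < k)%N -> X^T = X ->
  exists2 a, eigenvalue X a & psdmx (a%:M - X).
Proof.
move=> k0 sX; have sNX : (- X)^T = - X by rewrite linearN /= sX.
have [a /(eigenvalue_colP _ sNX)[x hx x0] pa] := min_eigenvalue k0 sNX.
exists (- a); last by rewrite raddfN /= addrC.
apply/eigenvalue_colP => //; exists x => //.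
by rewrite scaleNr -hx mulNmx opprK.
Qed.

End QuadraticForms.

(** * Nonzero spectrum of [B *m B^T] through [B^T *m B] *)

Section GramMatrix.
Context (R : realType).

(** The left inverse makes [B] injective, so [B^T *m B] is positive definite. The maps [B] and [B^T]
    carry eigenvectors for nonzero eigenvalues between the two products. *)
Lemma lambda_gram (m r : nat) (B : 'M[R]_(m, r)) (D : 'M[R]_(r, m)) :
  (0 < r)%N -> D *m B = 1%:M ->
  [/\ 0 < lambda_1 (B *m B^T),
      forall t, psdmx (B^T *m B - t%:M) <-> t <= lambda_1 (B *m B^T) &
      forall t, psdmx (t%:M - B^T *m B) <-> lambda_max (B *m B^T) <= t].
Proof.
move=> r0 DB; set M := B *m B^T; set S := B^T *m B.
have sM : M^T = M by rewrite /M trmx_mul trmxK.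
have sS : S^T = S by rewrite /S trmx_mul trmxK.
have [a ea pa] := min_eigenvalue r0 sS.
have [b eb pb] := max_eigenvalue r0 sS.
have injB (x : 'cV_r) : x != 0 -> B *m x != 0.
  apply: contra_neq => Bx0.
  by rewrite -[x]mul1mx -DB -mulmxA Bx0 mulmx0.
have S_gt0 c : eigenvalue S c -> 0 < c.
  move=> /(eigenvalue_colP _ sS)[x Sx x0].
  have : 0 < qf S x by rewrite /S -[B^T]mulmx1 qf_congr qf1_gt0 ?injB.
  by rewrite (qf_eigen Sx) pmulr_lgt0 // qf1_gt0.
have SM c : eigenvalue S c -> eigenvalue M c.
  move=> /(eigenvalue_colP _ sS)[x Sx x0].
  apply/eigenvalue_colP => //; exists (B *m x); last exact: injB.
  by rewrite /M -mulmxA (mulmxA B^T) -/S Sx scalemxAr.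
have MS c : c != 0 -> eigenvalue M c -> eigenvalue S c.
  move=> c0 /(eigenvalue_colP _ sM)[x Mx x0].
  apply/eigenvalue_colP => //; exists (B^T *m x).
    by rewrite /S -mulmxA (mulmxA B) -/M Mx scalemxAr.
  apply: contraNneq x0 => Bx0; move/eqP: Mx.
  by rewrite /M -mulmxA Bx0 mulmx0 eq_sym scaler_eq0 (negPf c0).
have le_a c : eigenvalue S c -> a <= c by exact: psdmx_le_eigenvalue.
have le_b c : eigenvalue S c -> c <= b by exact: psdmx_ge_eigenvalue.
(* Exhibiting [a] as the unique candidate rules out the default value of [xget]. *)
have la : lambda_1 M = a.
  apply: xget_unique => [|c [ec c0 hc]].
    split; [exact: SM|by rewrite gt_eqF ?S_gt0|].
    by move=> c ec c0; apply/le_a/MS.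
  apply/eqP; rewrite eq_le le_a ?MS // hc //; first exact: SM.
  by rewrite gt_eqF ?S_gt0.
have lb : lambda_max M = b.
  have ub c : eigenvalue M c -> c <= b.
    (* [M] may have the eigenvalue 0, which [S] lacks; it lies below [b] since [b] is positive. *)
    have [->|c0] := eqVneq c 0; first by move=> _; exact/ltW/S_gt0.
    by move=> ec; apply/le_b/MS.
  apply: xget_unique => [|c [ec hc]]; first by split; [exact: SM|].
  by apply/eqP; rewrite eq_le ub //= hc //; exact: SM.
rewrite la lb; split=> [|t|t]; first exact: S_gt0.
  split=> [pt|ta]; first exact: psdmx_le_eigenvalue ea.
  rewrite (_ : S - _ = (S - a%:M) + (a - t)%:M); last first.
    by rewrite raddfB /= addrA subrK.
  by apply: psdmxD => //; apply: psdmx_scalar; rewrite subr_ge0.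
split=> [pt|bt]; first exact: psdmx_ge_eigenvalue eb.
rewrite (_ : _ - S = (t - b)%:M + (b%:M - S)); last first.
  by rewrite raddfB /= addrA subrK.
by apply: psdmxD => //; apply: psdmx_scalar; rewrite subr_ge0.
Qed.

End GramMatrix.

(** * Diagonal scalings and the semidefinite constraints *)

Section DiagonalScaling.
Context (R : realType).

(** Lets both problems range over the same positive vectors, with [w] holding the squared diagonal
    of [L]. *)
Lemma diag_pdP (m : nat) (L : 'M[R]_m) :
  diag_pd L <->
  exists2 w : 'rV[R]_m, (forall i, 0 < w 0 i) & L = sqrt_diag_mx w.
Proof.
split=> [[dL [_ pL]]|[w w0 ->]].
  have L0 i : 0 < L i i.
    have /pL : delta_mx i 0 != 0 :> 'cV[R]_m.
      by apply/eqP => /matrixP /(_ i 0) /eqP; rewrite !mxE !eqxx oner_eq0.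
    by rewrite trmx_delta -rowE -colE !mxE.
  exists (\row_i (L i i ^+ 2)) => [i|]; first by rewrite mxE exprn_gt0.
  have /is_diag_mxP hL := dL.
  apply/matrixP => i j; rewrite !mxE.
  have [->|ij] := eqVneq i j; last by rewrite hL // mulr0n.
  by rewrite sqrtr_sqr gtr0_norm // mulr1n.
split; first exact: diag_mx_is_diag.
split=> [|x x0]; first by rewrite tr_diag_mx.
have [i xi0] : exists i, x i 0 != 0.
  apply/existsP; apply: contraNT x0 => /existsPn h.
  apply/eqP/matrixP => i j; rewrite ord1 mxE.
  by have := h i; rewrite negbK => /eqP.
rewrite mul_mx_diag mxE (bigD1 i) //= ltr_pwDl //.
  by rewrite !mxE mulrAC pmulr_lgt0 ?sqrtr_gt0 // -expr2 exprn_even_gt0.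
apply: sumr_ge0 => j _; rewrite !mxE mulrAC.
by rewrite mulr_ge0 ?sqrtr_ge0 // -expr2 sqr_ge0.
Qed.

Context (m n r : nat) (Q : 'M[R]_n) (A : 'M[R]_(m, n)) (Rq : 'M[R]_n).
Context (P : 'M[R]_(n, r)).
Implicit Types (t : R) (w : 'rV[R]_m).

(** The constraint matrices are affine in [(t, w)] and the objective is linear. *)
Lemma convex_problem_feasible : convex_problem (@objective R m) (feasible A Rq P).
Proof.
split=> [x y k|k x y _ _]; last by [].
rewrite !inE => -[x1 x2 x3] [y1 y2 y3].
have k0 : 0 <= k%:num by [].
have k1 : 0 <= 1 - k%:num by rewrite subr_ge0.
have dE : diag_mx (conv k x y).2 =
    k%:num *: diag_mx x.2 + (1 - k%:num) *: diag_mx y.2.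
  by rewrite -!linearZ -linearD.
split.
- move=> i; rewrite !mxE.
  suff: 0 < k%:num * x.2 0 i + (1 - k%:num) * y.2 0 i by [].
  (* One strictly positive summand suffices: the first, unless its weight is 0, and then the
     combination is [y]. *)
  have [->|kn0] := eqVneq k%:num 0; first by rewrite mul0r add0r subr0 mul1r.
  by rewrite ltr_pwDl ?mulr_gt0 ?mulr_ge0 // ?lt0r ?kn0 // ltW.
- have := psdmxD (psdmxZ k0 x2) (psdmxZ k1 y2).
  congr psdmx; rewrite /= !scalerBr addrACA -opprD; congr (_ - _).
    by rewrite !scale_scalar_mx -raddfD.
  by rewrite dE !(mulmxDr, mulmxDl) -!(scalemxAr, scalemxAl).
- have := psdmxD (psdmxZ k0 x3) (psdmxZ k1 y3).
  congr psdmx; rewrite dE.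
  rewrite !(mulmxDr, mulmxDl) -!(scalemxAr, scalemxAl).
  by rewrite !scalerDr addrACA -scalerDl addrCA subrr addr0 scale1r.
Qed.

Hypotheses (r_gt0 : (0 < r)%N) (hQ : Rq *m Rq^T = invmx Q).
Hypotheses (hPo : P^T *m P = 1%:M) (hPr : (P^T == (Rq^T *m A^T)^T)%MS).

Let K := A *m Rq *m P.
Let gram w : 'M[R]_r := K^T *m diag_mx w *m K.
Let M w : 'M[R]_m := (sqrt_diag_mx w *m K) *m (sqrt_diag_mx w *m K)^T.

(** The rows of [A *m Rq] lie in the row space of [P^T], so the projection [P *m P^T] fixes them. *)
Let KPT : A *m Rq = K *m P^T.
Proof.
case/andP: hPr => _ /submxP[E]; rewrite trmx_mul !trmxK /K => ->.
by rewrite -!mulmxA (mulmxA P^T) hPo mul1mx.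
Qed.

(** The other inclusion of spaces gives [P^T = D *m A *m Rq], hence [D *m K = P^T *m P = 1%:M]; the
    scaling is undone by inverse square roots. *)
Let scaled_left_inverse w : (forall i, 0 < w 0 i) ->
  exists D : 'M[R]_(r, m), D *m (sqrt_diag_mx w *m K) = 1%:M.
Proof.
case/andP: hPr => /submxP[D hD] _ w0.
exists (D *m diag_mx (map_mx (fun a => (Num.sqrt a)^-1) w)).
rewrite -mulmxA (mulmxA (diag_mx _)) mulmx_diag.
rewrite (_ : diag_mx _ = 1%:M) ?mul1mx; last first.
  apply/matrixP => i j; rewrite !mxE; case: eqVneq => //= _.
  by rewrite mulVf // gt_eqF // sqrtr_gt0.
by move: hD; rewrite trmx_mul !trmxK /K !mulmxA => <-; exact: hPo.
Qed.

Let gramE w : (forall i, 0 < w 0 i) ->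
  (sqrt_diag_mx w *m K)^T *m (sqrt_diag_mx w *m K) = gram w.
Proof.
move=> w0; rewrite trmx_mul tr_diag_mx mulmxA -(mulmxA K^T) mulmx_diag /gram.
congr (_ *m diag_mx _ *m _); apply/matrixP => i j; rewrite !mxE ord1.
by rewrite -expr2 sqr_sqrtr // ltW.
Qed.

Let ratioE w :
  eigenvalue_ratio Q A (sqrt_diag_mx w) = lambda_max (M w) / lambda_1 (M w).
Proof.
rewrite /eigenvalue_ratio /M.
suff -> : (sqrt_diag_mx w *m K) *m (sqrt_diag_mx w *m K)^T =
    sqrt_diag_mx w *m A *m invmx Q *m A^T *m sqrt_diag_mx w by [].
rewrite trmx_mul tr_diag_mx -hQ -/(sqrt_diag_mx w).
have -> : sqrt_diag_mx w *m A *m (Rq *m Rq^T) *m A^T *m sqrt_diag_mx w =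
    sqrt_diag_mx w *m ((A *m Rq) *m (A *m Rq)^T) *m sqrt_diag_mx w.
  by rewrite trmx_mul !mulmxA.
rewrite KPT [(K *m _)^T]trmx_mul trmxK (mulmxA _ P) -(mulmxA K) hPo mulmx1.
by rewrite !mulmxA.
Qed.

(** Both constraints compress to the range of [P]. On its orthogonal complement the first one only
    asks for [0 <= t]. *)
Let feasible_gram t w : (forall i, 0 < w 0 i) ->
  feasible A Rq P (t, w) <-> psdmx (t%:M - gram w) /\ psdmx (gram w - 1%:M).
Proof.
move=> w0; rewrite /feasible /=.
have -> : Rq^T *m A^T *m diag_mx w *m A *m Rq = P *m gram w *m P^T.
  rewrite -trmx_mul -mulmxA KPT trmx_mul trmxK /gram !mulmxA //.
have PT (X : 'M[R]_r) : P^T *m (P *m X *m P^T) *m P = X.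
  by rewrite !mulmxA hPo mul1mx -mulmxA hPo mulmx1.
have -> : P^T *m (P *m gram w *m P^T - 1%:M) *m P = gram w - 1%:M.
  by rewrite mulmxBr mulmxBl PT mulmx1 hPo.
split=> [[_ h1 h2]|[h1 h2]]; split=> //.
  have := psdmx_congr P h1.
  by rewrite mulmxBr mulmxBl PT mul_mx_scalar -scalemxAl hPo scalemx1.
(* Adding the two inequalities shows that [t - 1] is nonnegative, as [r] is positive. *)
have t0 : 0 <= t.
  have := psdmxD h1 h2; rewrite addrA subrK -raddfB /=.
  by move=> /(psdmx_scalar_ge0 r_gt0); lra.
(* [1 - P P^T] is the orthogonal projection along the range of [P]. *)
pose N := 1%:M - P *m P^T.
have sN : N^T = N by rewrite linearB /= trmx_mul trmxK tr_scalar_mx.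
have NN : N^T *m 1%:M *m N = N.
  rewrite sN mulmx1 {1}/N mulmxBl mul1mx /N mulmxBr mulmx1 mulmxA.
  by rewrite -(mulmxA P) hPo mulmx1 subrr subr0.
have -> : t%:M - P *m gram w *m P^T =
    (P^T)^T *m (t%:M - gram w) *m P^T + t *: (N^T *m 1%:M *m N).
  rewrite trmxK NN mulmxBr mulmxBl mul_mx_scalar -scalemxAl scalerBr scalemx1.
  by rewrite addrACA [RHS]addrAC addrCA; apply/matrixP => i j; rewrite !mxE; ring.
apply: psdmxD; first exact: psdmx_congr.
by apply: psdmxZ => //; apply/psdmx_congr/psdmx_scalar.
Qed.

Lemma feasible_ratio_le t w : feasible A Rq P (t, w) ->
  eigenvalue_ratio Q A (sqrt_diag_mx w) <= t.
Proof.
move=> F; have [w0 _ _] := F; have /(feasible_gram _ w0)[h2 h3] := F.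
have [D /(lambda_gram r_gt0)] := scaled_left_inverse w0.
rewrite gramE // ratioE => -[l0 h1 hmax].
have t0 : 0 <= t.
  have := psdmxD h2 h3; rewrite addrA subrK -raddfB /=.
  by move=> /(psdmx_scalar_ge0 r_gt0); lra.
move/hmax: h2 => ht; move/h1: h3 => l1.
(* [lambda_max <= t <= t * lambda_1], the latter from [0 <= t] and [1 <= lambda_1]. *)
by rewrite ler_pdivrMr //; apply: le_trans ht _; rewrite ler_peMr.
Qed.

Lemma ratio_feasible w : (forall i, 0 < w 0 i) -> exists2 c, 0 < c &
  feasible A Rq P (eigenvalue_ratio Q A (sqrt_diag_mx w), c *: w).
Proof.
move=> w0; have [D /(lambda_gram r_gt0)] := scaled_left_inverse w0.
rewrite gramE // ratioE -/(M w) => -[l0 h1 hmax].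
have c0 : 0 < (lambda_1 (M w))^-1 by rewrite invr_gt0.
exists (lambda_1 (M w))^-1 => //; apply/feasible_gram.
  by move=> i; rewrite mxE mulr_gt0.
have -> : gram ((lambda_1 (M w))^-1 *: w) = (lambda_1 (M w))^-1 *: gram w.
  by rewrite /gram linearZ /= -scalemxAr -scalemxAl.
(* Dividing [lambda_1 <= gram w <= lambda_max] by [lambda_1] leaves the bounds 1 and the ratio. *)
split.
  have /hmax/(psdmxZ (ltW c0)) := lexx (lambda_max (M w)).
  by rewrite scalerBr scale_scalar_mx mulrC.
have /h1/(psdmxZ (ltW c0)) := lexx (lambda_1 (M w)).
by rewrite scalerBr scale_scalar_mx mulVf // gt_eqF.
Qed.

End DiagonalScaling.

Theorem theorem8 (R : realType) (m n : nat) (hm : (0 < m)%N) (hn : (0 < n)%N)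
    (Q : 'M[R]_n) (hQ : pdmx Q)
    (A : 'M[R]_(m, n)) (hA : \rank A = minn m n)
    (Rq : 'M[R]_n) (hRq : cholesky_factor (invmx Q) Rq)
    (* s is the dimension of the null space {x | A x = 0}; kermx is the left
       kernel, hence the transpose *)
    (s : nat) (hs : s = \rank (kermx A^T))
    (P : 'M[R]_(n, n - s)) (hPo : P^T *m P = 1%:M)
    (* equality of column spaces *)
    (hPr : (P^T == (Rq^T *m A^T)^T)%MS) :
  [/\ convex_problem (@objective R m) (feasible A Rq P),
      (forall (t : R) (w : 'rV[R]_m),
         minimizes (@objective R m) (feasible A Rq P) (t, w) ->
         minimizes (eigenvalue_ratio Q A) (@diag_pd R m) (sqrt_diag_mx w)) &
      ((exists L : 'M[R]_m, minimizes (eigenvalue_ratio Q A) (@diag_pd R m) L) ->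
       exists (t : R) (w : 'rV[R]_m),
         minimizes (@objective R m) (feasible A Rq P) (t, w))].
Proof.
have [_ _ hF] := hRq.
(* By rank-nullity [n - s] is the rank of [A], which is [minn m n]. *)
have r0 : (0 < n - s)%N.
  rewrite hs mxrank_ker mxrank_tr hA subKn ?geq_minr //.
  by rewrite leq_min hm hn.
have ratio_le := feasible_ratio_le r0 hF hPo hPr.
have ratio_ex := ratio_feasible r0 hF hPo hPr.
split; first exact: convex_problem_feasible.
- move=> t w [F tmin]; have [w0 _ _] := F.
  split=> [|_ /diag_pdP[v v0 ->]]; first by apply/diag_pdP; exists w.
  (* The ratio at [w] is at most [t], and [t] is at most the ratio at [v], since a multiple of [v]
     is feasible with that value. *)
  apply: le_trans (ratio_le _ _ F) _.
  by have [c _ /tmin] := ratio_ex v v0.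
- move=> [_ [/diag_pdP[w w0 ->] Lmin]]; have [c c0 F] := ratio_ex w w0.
  (* The rescaled minimizer is optimal: any feasible [(t, v)] has [t] at least the ratio at [v]. *)
  exists (eigenvalue_ratio Q A (sqrt_diag_mx w)), (c *: w).
  split=> // -[t v] Fv; have [v0 _ _] := Fv.
  apply: le_trans (ratio_le _ _ Fv).
  by apply: Lmin; apply/diag_pdP; exists v.
Qed.
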